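(* Let $p\ge1$ be an integer and let $(\Sigma,F)$ be a partial cellular automaton. Then $(\Sigma,F)$ is asymptotically $p$-periodic if and only if its trace $\tau_F$ is weakly $p$-preperiodic.
   Context: Let $A$ be a finite alphabet and $\mathbb M\in\{\mathbb N,\mathbb Z\}$; $A^{\mathbb M}$ carries the product topology of the discrete topology, and the shift is $\sigma(x)_i=x_{i+1}$. A subshift is a nonempty closed set $\Sigma\subseteq A^{\mathbb M}$ with $\sigma(\Sigma)\subseteq\Sigma$ if $\mathbb M=\mathbb N$, and $\sigma(\Sigma)=\Sigma$ if $\mathbb M=\mathbb Z$. A partial cellular automaton (PCA) is a pair $(\Sigma,F)$ with $\Sigma$ a subshift and $F:\Sigma\to\Sigma$ continuous with $F\sigma=\sigma F$. The asymptotic set $\omega_F$ is the set of all $y\in\Sigma$ such that for some $x\in\Sigma$, $y$ is an adhering value (the limit of a subsequence) of $(F^t(x))_{t\in\mathbb N}$. $(\Sigma,F)$ is asymptotically $p$-periodic if $F^p(y)=y$ for all $y\in\omega_F$. The (central) trace is the onesided subshift $\tau_F=\{(F^t(x)_0)_{t\in\mathbb N}\mid x\in\Sigma\}$. It is weakly $p$-preperiodic if for every $z\in\tau_F$ there is $q\in\mathbb N$ with $\sigma^{p+q}(z)=\sigma^q(z)$. *)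

(* Defs.v *)
From HB Require Import structures.
From mathcomp Require Import all_boot all_order all_algebra.
From mathcomp Require Import all_classical all_reals all_analysis.

Set Implicit Arguments.
Unset Strict Implicit.
Unset Printing Implicit Defensive.

Local Open Scope classical_set_scope.

Inductive sidedness := OneSided | TwoSided.

Definition cell (M : sidedness) : countType :=
  match M with OneSided => nat | TwoSided => int end.

Coercion cell : sidedness >-> countType.

Definition cell0 (M : sidedness) : M :=
  match M with OneSided => 0%N | TwoSided => 0%R end.

Definition cell_succ (M : sidedness) : M -> M :=
  match M with OneSided => fun i => i.+1 | TwoSided => fun i => (i + 1)%R end.

(* The alias fixes the topology on configurations: the function type
   [M -> A] itself may carry other topologies. *)
Definition config (M : sidedness) (A : finType) : Type :=
  prod_topology (fun _ : M => discrete_topology A).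

HB.instance Definition _ (M : sidedness) (A : finType) :=
  Topological.on (config M A).

Definition cshift (M : sidedness) (A : finType) (x : config M A) : config M A :=
  fun i => x (cell_succ i).

Definition subshift (M : sidedness) (A : finType) (S : set (config M A)) : Prop :=
  [/\ S !=set0,
      closed S &
      match M with
      | OneSided => @cshift M A @` S `<=` S
      | TwoSided => @cshift M A @` S = S
      end].

(* A map S -> S is represented by a total map of which only the restriction to
   S matters; continuity is with respect to the subspace topology of S. *)
Definition partial_cellular_automaton (M : sidedness) (A : finType)
    (S : set (config M A)) (F : config M A -> config M A) : Prop :=
  [/\ subshift S,
      forall x, S x -> S (F x),
      {within S, continuous F} &
      forall x, S x -> F (cshift x) = cshift (F x)].

Definition adhering_value (T : topologicalType) (u : nat -> T) (y : T) : Prop :=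
  exists2 s : nat -> nat, increasing_seq s & u (s n) @[n --> \oo] --> y.

Definition asymptotic_set (M : sidedness) (A : finType) (S : set (config M A))
    (F : config M A -> config M A) : set (config M A) :=
  [set y | S y /\ exists2 x, S x & adhering_value (fun t => iter t F x) y].

Definition asymptotically_periodic (M : sidedness) (A : finType) (p : nat)
    (S : set (config M A)) (F : config M A -> config M A) : Prop :=
  forall y, asymptotic_set S F y -> iter p F y = y.

Definition trace (M : sidedness) (A : finType) (S : set (config M A))
    (F : config M A -> config M A) : set (config OneSided A) :=
  [set z | exists2 x, S x & z = fun t => iter t F x (cell0 M)].

Definition weakly_preperiodic (A : finType) (p : nat)
    (Z : set (config OneSided A)) : Prop :=
  forall z, Z z ->
    exists q : nat, iter (p + q) (@cshift _ _) z = iter q (@cshift _ _) z.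

(* Main.v *)
Require Import Defs.
From mathcomp Require Import all_boot all_order all_algebra.
From mathcomp Require Import all_classical all_reals all_analysis.

(** Both properties concern whether an orbit [F^t x] eventually agrees with its
    own delay by [p] steps, and convergence of configurations is eventual
    agreement cell by cell ([config_cvgP]), so each can be read off the other.

    If the trace of [x] failed to be eventually [p]-periodic, the times [t] with
    [F^(t+p)(x)_0 <> F^t(x)_0] would be unbounded. By compactness, some
    subsequence of the orbit taken along these bad times converges
    ([convergent_subsequence_along]), say to [y]. By continuity [F^(t+p) x]
    converges to [F^p y] along the same times, and [F^p y = y] because [y] lies
    in the asymptotic set. Hence both [F^t(x)_0] and [F^(t+p)(x)_0] eventually
    equal [y_0], which contradicts badness.

    Conversely, let [y] be the limit of [F^t x] along an increasing sequence of
    times, and fix a cell [i]. What the orbit shows at cell [i] is what the orbit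
    of a shifted configuration of the subshift shows at cell 0
    ([trace_orbit_at_cell]), so it is an element of the trace and is eventually
    [p]-periodic. Passing to the limit gives [F^p(y)_i = y_i]. *)

Local Open Scope classical_set_scope.

(** In the product topology convergence is coordinatewise, and in a discrete
    alphabet the letter [y i] is itself a neighbourhood. *)
Lemma config_cvgP {M : sidedness} {A : finType} {G : set_system (config M A)}
    {y : config M A} : Filter G ->
  (G --> y) <-> forall i, \forall z \near G, z i = y i.
Proof.
move=> FG; split=> [Gy i|Gy].
  apply: (Gy [set z | z i = y i]).
  have /(_ [set y i]) := @proj_continuous M (fun _ => discrete_topology A) i y.
  by apply; exact: discrete_set1.
apply/cvg_sup => i U.
have /= -> := @nbhsE (initial_topology (fun f : config M A => f i)) y.
move=> [B [[C oC <-] Cy] BU].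
by apply: filterS (Gy i) => z /= zi; apply: BU; rewrite /= zi.
Qed.

Lemma near_cell_eq {M : sidedness} {A : finType} {u : nat -> config M A}
    {y : config M A} (i : M) :
  u n @[n --> \oo] --> y -> \forall n \near \oo, u n i = y i.
Proof. by move=> uy; exact: (iffLR (config_cvgP _) uy i). Qed.

(** Enumerating the countably many cells by [pickle] gives a countable family of
    neighbourhoods of [y] that determines convergence to [y]; this is what lets a
    cluster point be reached by a sequence. *)
Lemma nbhs_cylinder {M : sidedness} {A : finType} (y : config M A) (n : nat) :
  nbhs y [set z | forall i : M, (pickle i < n)%N -> z i = y i].
Proof.
have near_coord (i : M) : nbhs y [set z | z i = y i].
  by have := iffLR (config_cvgP (nbhs_filter y)) (fun U yU => yU); exact.
elim: n => [|n IHn]; first exact: filterS filterT.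
have step : nbhs y [set z | forall i : M, pickle i = n -> z i = y i].
  have [[i <-]|Ni] := pselect (exists i : M, pickle i = n).
    by apply: filterS (near_coord i) => z zi j /(pcan_inj pickleK) ->.
  by apply: filterS filterT => z _ i ni; case: Ni; exists i.
apply: filterS (filterI IHn step) => z [zlt zeq] i; rewrite ltnS leq_eqVlt.
by move=> /orP[/eqP/zeq|/zlt].
Qed.

Lemma compact_config (M : sidedness) (A : finType) :
  compact [set: config M A].
Proof.
have cptA : compact [set: discrete_topology A].
  by apply: finite_compact; exact: (@finite_finset A setT).
have := @tychonoff M (fun=> discrete_topology A) (fun=> setT) (fun=> cptA).
by congr compact; rewrite eqEsubset.
Qed.

(** Sequential compactness with control on the indices: the cluster point is
    taken along the filter at infinity restricted to [Q], so that every cylinder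
    around it is visited at arbitrarily late indices in [Q]. *)
Lemma convergent_subsequence_along {M : sidedness} {A : finType}
    (u : nat -> config M A) (Q : set nat) :
  (forall N, exists2 m, (N <= m)%N & Q m) ->
  exists s : nat -> nat, exists y : config M A,
    [/\ increasing_seq s, forall n, Q (s n) & u (s n) @[n --> \oo] --> y].
Proof.
move=> Qoo.
have PG : ProperFilter (within Q \oo).
  apply: Build_ProperFilter_ex => P [N _ NP].
  by have [m Nm Qm] := Qoo N; exists m; exact: NP.
have [|y [_ yu]] := @compact_config M A (u @ within Q \oo) _; first exact: filterT.
have next n N : exists m,
    [/\ (N < m)%N, Q m & forall i : M, (pickle i < n)%N -> u m i = y i].
  have uG : (u @ within Q \oo) [set u m | m in [set m | (N < m)%N /\ Q m]].
    by exists N.+1 => // m /= Nm Qm; exists m.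
  by have [_ [[m [Nm Qm] <-] um]] := yu _ _ uG (nbhs_cylinder y n); exists m.
have [f fP] := choice (fun nN : nat * nat => next nN.1 nN.2).
(* The n-th index follows the previous one and takes u into the n-th cylinder. *)
pose s := fix s n := if n is k.+1 then f (k.+1, s k) else f (0%N, 0%N).
have sP n : Q (s n) /\ forall i : M, (pickle i < n)%N -> u (s n) i = y i.
  by case: n => [|n]; [case: (fP (0%N, 0%N))|case: (fP (n.+1, s n))].
exists s, y; split; last 1 first.
- apply/config_cvgP => i; exists (pickle i).+1 => // n /= ltn.
  by have [_] := sP n; apply.
- by apply/increasing_seqP => n; case: (fP (n.+1, s n)).
- by move=> n; case: (sP n).
Qed.

Lemma iter_shiftE {M : sidedness} {A : finType} n (x : config M A) i :
  iter n (@cshift M A) x i = x (iter n (@cell_succ M) i).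
Proof. by elim: n i => //= n IHn i; rewrite /cshift IHn -iterSr. Qed.

Section PartialCellularAutomaton.
Context {M : sidedness} {A : finType} {S : set (config M A)}.
Context {F : config M A -> config M A}.
Context (hF : partial_cellular_automaton S F).

Lemma iter_stable t {x} : S x -> S (iter t F x).
Proof. by case: hF => _ SF _ _ Sx; elim: t => //= t; exact: SF. Qed.

Lemma iter_cvg p {u : nat -> config M A} {y : config M A} :
  (forall n, S (u n)) -> S y -> u n @[n --> \oo] --> y ->
  iter p F (u n) @[n --> \oo] --> iter p F y.
Proof.
case: hF => _ _ /subspace_continuousP cF _ Su Sy uy.
elim: p => //= p IHp.
apply: cvg_comp (cF _ (iter_stable p Sy)) => U.
move=> /IHp[N _ UN]; exists N => // n /UN; apply; exact: iter_stable.
Qed.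

Lemma shift_stable n {x} : S x -> S (iter n (@cshift M A) x).
Proof.
have shS z : S z -> S (cshift z).
  have [[_ _ shS] _ _ _] := hF; have {}shS : @cshift M A @` S `<=` S.
    by move: (M) (S) shS => [] // S0 ->.
  by move=> Sz; apply: shS; exists z.
by move=> Sx; elim: n => //= n; exact: shS.
Qed.

Lemma iter_shift t n {x} : S x ->
  iter t F (iter n (@cshift M A) x) = iter n (@cshift M A) (iter t F x).
Proof.
case: hF => _ _ _ comm Sx.
have comm1 z : S z -> iter t F (cshift z) = cshift (iter t F z).
  by move=> Sz; elim: t => //= t' ->; apply/comm/iter_stable.
by elim: n => //= n <-; apply/comm1/shift_stable.
Qed.

End PartialCellularAutomaton.

(** For a cell reached from the origin by successors, shift [x]. For a negative
    cell of the two-sided line the configuration must be shifted backwards, and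
    [w] is then a preimage of [x] under a power of the shift: it lies in [S]
    because the shift maps a two-sided subshift onto itself. *)
Lemma trace_orbit_at_cell {M : sidedness} {A : finType} {S : set (config M A)}
    {F : config M A -> config M A} {x : config M A} (i : M) :
  partial_cellular_automaton S F -> S x ->
  exists2 w, S w & forall t, iter t F x i = iter t F w (cell0 M).
Proof.
move=> hF Sx.
have fwd n : iter n (@cell_succ M) (cell0 M) = i ->
    exists2 w, S w & forall t, iter t F x i = iter t F w (cell0 M).
  move=> ni; exists (iter n (@cshift M A) x); first exact: (shift_stable hF).
  by move=> t; rewrite (iter_shift hF)// iter_shiftE ni.
case: M S F x i hF Sx fwd => S F x i hF Sx fwd.
  by apply: (fwd i); elim: i {fwd} => // n IHn; rewrite iterS IHn.
have addE n (j : int) : iter n (@cell_succ TwoSided) j = (j + n%:Z)%R.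
  by elim: n => [|n /= ->] /=; rewrite ?GRing.addr0// -GRing.addrA -[n.+1]addn1.
case: i fwd => n fwd; first by apply: (fwd n); rewrite addE GRing.add0r.
have shS : @cshift TwoSided A @` S = S by case: hF => -[].
have [w Sw wx] : exists2 w, S w & iter n.+1 (@cshift TwoSided A) w = x.
  elim: n.+1 x Sx {fwd} => [|k IHk] x Sx; first by exists x.
  have [z Sz <-] : (@cshift TwoSided A @` S) x by rewrite shS.
  by have [w Sw <-] := IHk z Sz; exists w.
exists w => // t.
by rewrite -wx (iter_shift hF)// iter_shiftE addE NegzE GRing.addNr.
Qed.

Lemma weakly_preperiodic_traceP (M : sidedness) (A : finType)
    (S : set (config M A)) (F : config M A -> config M A) (p : nat) :
  weakly_preperiodic p (trace S F) <->
  forall x, S x -> \forall t \near \oo,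
    iter p F (iter t F x) (cell0 M) = iter t F x (cell0 M).
Proof.
have addE n j : iter n (@cell_succ OneSided) j = (j + n)%N.
  by elim: n j => [|n IHn] j; rewrite ?addn0//= IHn addnS.
split=> [Zp x Sx|Fp z [x Sx ->]].
  have [|q qE] := Zp (fun t => iter t F x (cell0 M)); first by exists x.
  exists q => // t /= qt; move: (congr1 (fun z => z (t - q)%N) qE).
  by rewrite !iter_shiftE !addE addnCA subnK// iterD.
have [q _ qE] := Fp x Sx; exists q; apply: funext => t.
rewrite !iter_shiftE !addE addnCA iterD; apply: qE => /=; exact: leq_addl.
Qed.

Theorem proposition28 (p : nat) (hp : (0 < p)%N) (M : sidedness) (A : finType)
    (S : set (config M A)) (F : config M A -> config M A)
    (hF : partial_cellular_automaton S F) :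
  asymptotically_periodic p S F <-> weakly_preperiodic p (trace S F).
Proof.
rewrite weakly_preperiodic_traceP; split=> [per x Sx|pre y [Sy [x Sx]]].
  apply: contrapT => bad.
  pose Q := [set t | iter p F (iter t F x) (cell0 M) != iter t F x (cell0 M)].
  have Qoo N : exists2 m, (N <= m)%N & Q m.
    apply: contrapT => /forall2NP good; apply: bad; exists N => // t /= Nt.
    by apply/eqP; have [//|/negP] := good t; rewrite negbK.
  have [s [y [s_incr sQ sy]]] :=
    @convergent_subsequence_along _ _ (fun t => iter t F x) Q Qoo.
  have Sorb n : S (iter (s n) F x) by exact: (iter_stable hF).
  have Sy : S y.
    case: hF => -[_ clS _] _ _ _; apply: closed_cvg clS _ _ sy; exact: nearW.
  have Fy : iter p F y = y by apply: per; split => //; exists x => //; exists s.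
  have Fsy := iter_cvg hF p Sorb Sy sy.
  have [n [/= n1 n2]] := filter_ex
    (filterI (near_cell_eq (cell0 M) sy) (near_cell_eq (cell0 M) Fsy)).
  by have /eqP := sQ n; rewrite n1 n2 Fy.
case=> s s_incr sy; apply: funext => i.
have Sorb n : S (iter (s n) F x) by exact: (iter_stable hF).
have [w Sw wE] := trace_orbit_at_cell i hF Sx.
have [N _ NP] := pre w Sw.
have ys := near_cell_eq i sy.
have Fys := near_cell_eq i (iter_cvg hF p Sorb Sy sy).
(* Strictly increasing times satisfy n <= s n. *)
have late : \forall n \near \oo, (N <= s n)%N.
  exists N => // n /= Nn; apply: leq_trans Nn _.
  elim: n => // n IHn; apply: leq_ltn_trans IHn _.
  by move/increasing_seqP: s_incr => /(_ n).
have [n [/= [yn Fyn] sn]] := filter_ex (filterI (filterI ys Fys) late).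
by rewrite -yn -Fyn -iterD !wE iterD; exact: NP.
Qed.
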